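(* Let $\alpha,\lambda>0$ be real and, for all sufficiently large $n$, let $p=p_n=1-\frac{\lambda}{n^{\alpha}}$. Let $X_n$ be the number of correct guesses in the complete-feedback card guessing game after one asymmetric single-shelf shuffle with parameter $p_n$ of $n$ cards. Then, as $n\to\infty$, $$\mathbb P\{X_n=n\}\to\begin{cases}0,& 0<\alpha<1,\\ e^{-\lambda},&\alpha=1,\\ 1,&\alpha>1.\end{cases}$$
   Context: Asymmetric single-shelf shuffle with parameter $p\in(0,1)$: an ordered deck of $n$ cards labelled $1,\dots,n$ (card $1$ on top, card $n$ at the bottom) is given. Cards are drawn one by one from the bottom of the deck (so in the order $n,n-1,\dots,1$) and put on an initially empty pile; each drawn card is placed, independently, at the top of the pile with probability $p$ and at the bottom of the pile with probability $1-p$. The final pile is the shuffled deck. Game: cards are drawn one after the other from the top of the shuffled deck. Before each draw the player guesses the label of the card; afterwards the card is shown (complete feedback). For $p\ge\frac12$ (which holds for $p=p_n$ when $n$ is large) the player uses the following optimal strategy: the first guess is card $1$; as long as neither card $n-1$ nor card $n$ has been shown, the next guess is the label immediately following that of the most recently shown card; once one of the cards $n-1$ or $n$ has been shown, the player guesses the remaining (not yet shown) cards in descending order. $X_n$ denotes the total number of correct guesses. *)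

(* Defs.v *)
From mathcomp Require Import all_boot all_order all_algebra.
From mathcomp Require Import all_classical all_reals all_analysis.

Set Implicit Arguments.
Unset Strict Implicit.
Unset Printing Implicit Defensive.

Import Order.TTheory GRing.Theory Num.Theory.

Local Open Scope ring_scope.

(* Cards are natural numbers with labels 1, ..., n; a deck or a pile is the
   sequence of its cards from top to bottom. *)

Definition place (to_top : bool) (c : nat) (pile : seq nat) : seq nat :=
  if to_top then c :: pile else rcons pile c.

(* The bit w i is the choice made for card i + 1 (true: top, false: bottom).
   As foldr consumes its list from the right, the cards are placed in the order
   n, n - 1, ..., 1, that is, drawn from the bottom of the ordered deck. *)
Definition shelf_shuffle (n : nat) (w : {ffun 'I_n -> bool}) : seq nat :=
  foldr (fun i pile => place (w i) i.+1 pile) [::] (enum 'I_n).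

(* The n choices are independent, each being "top" with probability p. *)
Definition shelf_prob (R : realType) (p : R) (n : nat)
    (E : pred {ffun 'I_n -> bool}) : R :=
  \sum_(w | E w) \prod_(i < n) (if w i then p else 1 - p).

(* The next guess, where shown lists the cards already shown, in the order in
   which they appeared.  Guessing the largest card not yet shown at every step
   is guessing the remaining cards in descending order. *)
Definition guess (n : nat) (shown : seq nat) : nat :=
  if shown is [::] then 1%N
  else if (n.-1 \in shown) || (n \in shown)
  then (\max_(c <- iota 1 n | c \notin shown) c)%N
  else (last 0%N shown).+1.

Definition correct_guesses (n : nat) (deck : seq nat) : nat :=
  (\sum_(k < n) (guess n (take k deck) == nth 0 deck k))%N.

(* X_n, as a random variable on the space of choices. *)
Definition X (n : nat) (w : {ffun 'I_n -> bool}) : nat :=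
  correct_guesses n (shelf_shuffle w).

(* Main.v *)
Require Import Defs.
From mathcomp Require Import all_boot all_order all_algebra.
From mathcomp Require Import all_classical all_reals all_analysis.
From mathcomp Require Import zify ring lra.

Import Order.TTheory GRing.Theory Num.Theory.
Import numFieldNormedType.Exports.

Local Open Scope classical_set_scope.
Local Open Scope ring_scope.

(* The shuffled deck consists of the cards sent to the top, in increasing order,
   followed by the cards sent to the bottom, in decreasing order.  All guesses
   are correct exactly when the deck is still ordered, i.e. when the cards
   1, ..., n - 1 all went to the top; this has probability p ^+ n.-1.  With
   x = 1 - p, the limit follows from
   expR (- (N x / (1 - x))) <= (1 - x) ^+ N <= expR (- (N x)) at N = n - 1. *)

(** The descending rule can only be active here once [k = n - 1]; the one card left is then [n], so
    it agrees with the successor rule. *)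
Lemma guess_iota (n k : nat) : (k < n)%N -> guess n (iota 1 k) = k.+1.
Proof.
case: k => [//|k] lt_kn; rewrite /guess -[iota 1 k.+1]/(1%N :: iota 2 k).
rewrite -[1%N :: iota 2 k]/(iota 1 k.+1) !mem_iota.
case: ifP => [seen|_]; last by rewrite -nth_last size_iota nth_iota.
have -> : n = k.+2 by move: lt_kn seen; case: n => [|[|n]] //=; rewrite ?add1n; lia.
rewrite -{1}[k.+2]addn1 iotaD big_cat big1_seq ?max0n; last first.
  by move=> c /andP[/negP nc c_in].
by rewrite big_cons big_nil mem_iota ltnn andbF /= maxn0.
Qed.

Lemma correct_guesses_eq (n : nat) (deck : seq nat) :
  size deck = n -> (correct_guesses n deck == n) = (deck == iota 1 n).
Proof.
move=> sz_deck; apply/idP/eqP => [all_ok|->]; last first.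
  rewrite /correct_guesses (eq_bigr (fun=> 1%N)) ?sum1_card ?card_ord //.
  by move=> k _; rewrite take_iota (minn_idPl (ltnW _)) // guess_iota // nth_iota // eqxx.
have ok k : (k < n)%N -> guess n (take k deck) = nth 0%N deck k.
  move=> lt_kn; apply/eqP; apply/negPn/negP => ko.
  (* One wrong guess leaves at most [n - 1] correct ones. *)
  move: all_ok; rewrite /correct_guesses (bigD1 (Ordinal lt_kn)) //= (negPf ko) add0n.
  apply/negP; rewrite neq_ltn -[X in (_ < X)%N]card_ord -sum1_card.
  rewrite [X in (_ < X)%N](bigD1 (Ordinal lt_kn)) //= add1n ltnS leq_sum // => i _.
  exact: leq_b1.
(* Induction on prefixes: after seeing [iota 1 k] the guess is [k.+1], and being correct it is also
   the next card. *)
suff take_id k : (k <= n)%N -> take k deck = iota 1 k.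
  by rewrite -(take_id n) // -sz_deck take_size.
elim: k => [|k IHk] lt_kn; first by rewrite take0.
rewrite (take_nth 0%N) ?sz_deck // -ok // IHk ?(ltnW lt_kn) // guess_iota //.
by rewrite -cats1 -[k.+1 in RHS]addn1 iotaD.
Qed.

(* A card sent to the bottom ends up below every larger card, so only the
   choice made for the largest card is irrelevant. *)
Lemma foldr_place_iota (b : nat -> bool) (m k : nat) :
  (foldr (fun j pile => place (b j) j.+1 pile) [::] (iota m k) == iota m.+1 k)
  = all b (iota m k.-1).
Proof.
elim: k m => [//|[|k] IHk] m; first by rewrite /= /place; case: (b m); rewrite /= eqxx.
rewrite -[iota m k.+2]/(m :: iota m.+1 k.+1) -[iota m.+1 k.+2]/(m.+1 :: iota m.+2 k.+1).
rewrite [foldr _ _ (_ :: _)]/= -[k.+2.-1]/k.+1 [all _ (iota m k.+1)]/= -IHk.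
rewrite -[place (b m.+1) _ _]/(foldr (fun j pile => place (b j) j.+1 pile) [::]
  (iota m.+1 k.+1)).
rewrite {1}/place; case: (b m); first by rewrite eqseq_cons eqxx.
apply/negP => /eqP/(congr1 (last 0%N)); rewrite last_rcons /= => last_eq.
have := mem_last m.+2 (iota m.+3 k); rewrite -last_eq.
by rewrite -[_ :: _]/(iota m.+2 k.+1) mem_iota ltnn.
Qed.

Lemma size_shelf_shuffle (n : nat) (w : {ffun 'I_n -> bool}) :
  size (shelf_shuffle w) = n.
Proof.
rewrite -[RHS](size_enum_ord n) /shelf_shuffle.
by elim: (enum 'I_n) => //= i s <-; rewrite /place; case: (w i); rewrite ?size_rcons.
Qed.

Lemma X_eq (n : nat) (w : {ffun 'I_n -> bool}) :
  (X w == n) = [forall i : 'I_n, (i.+1 < n)%N ==> w i].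
Proof.
rewrite /X correct_guesses_eq ?size_shelf_shuffle //.
case: n w => [|n] w; first by rewrite /shelf_shuffle enum_ord0; apply/esym/forallP => -[].
(* The choices are extended to all naturals through [inord], so that the result on [iota]
   applies. *)
have -> : shelf_shuffle w =
    foldr (fun j pile => place (w (inord j)) j.+1 pile) [::] (iota 0 n.+1).
  rewrite -val_enum_ord foldr_map /shelf_shuffle.
  by elim: (enum _) => //= i s ->; rewrite inord_val.
rewrite foldr_place_iota; apply/allP/forallP => /= [ok i|ok j].
  by apply/implyP => lt_in; rewrite -[i]inord_val ok // mem_iota.
rewrite mem_iota /= add0n => lt_jn.
by have /implyP := ok (inord j); apply; rewrite inordK ?ltnS // ltnW.
Qed.

Lemma shelf_prob_X_eq (R : realType) (q : R) (n : nat) :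
  shelf_prob q (fun w : {ffun 'I_n -> bool} => X w == n) = q ^+ n.-1.
Proof.
pose Q (i : 'I_n) : pred bool := fun b => (i.+1 < n)%N ==> b.
rewrite /shelf_prob (eq_bigl (fun w => w \in family Q)); last first.
  by move=> w; rewrite X_eq; apply: eq_forallb.
(* The event restricts each choice separately, so the sum factors over the cards: [q] for each card
   below [n], and [q + (1 - q) = 1] for card [n]. *)
rewrite -(bigA_distr_big_dep _ (fun i b => if b then q else 1 - q)) {}/Q.
case: n => [|n]; first by rewrite big_ord0.
rewrite big_ord_recr /= ltnn big_bool /= addrC subrK mulr1.
rewrite (eq_bigr (fun=> q)) ?prodr_const ?card_ord // => i _.
by rewrite ltnS ltn_ord big_mkcond big_bool /= addr0.
Qed.

(** Both bounds are [n]-th powers of [1 + t <= expR t]: at [t = - x] for the upper one, and at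
    [t = x / (1 - x)], where [1 + t = (1 - x)^-1], for the lower one. *)
Lemma exprB1_bounds (R : realType) (x : R) (n : nat) : x < 1 ->
  expR (- (n%:R * x / (1 - x))) <= (1 - x) ^+ n <= expR (- (n%:R * x)).
Proof.
move=> x1; have y0 : 0 < 1 - x by rewrite subr_gt0.
rewrite -mulrA -mulrN -[- (n%:R * x)]mulrN !expRM_natl; apply/andP; split; apply: lerXn2r;
  rewrite ?nnegrE ?expR_ge0 ?(ltW y0) //; last exact: expR_ge1Dx.
rewrite expRN -[leRHS]invrK lef_pV2 ?posrE ?expR_gt0 ?invr_gt0 //.
apply: le_trans (expR_ge1Dx _); rewrite le_eqVlt; apply/orP; left; apply/eqP.
by field; rewrite lt0r_neq0.
Qed.

Lemma cvg_exprB1 (R : realType) (N : nat -> nat) (x : nat -> R) (c : R) :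
  x n @[n --> \oo] --> (0 : R) -> (N n)%:R * x n @[n --> \oo] --> c ->
  (1 - x n) ^+ N n @[n --> \oo] --> expR (- c).
Proof.
move=> x0 Nx.
apply: (@squeeze_cvgr _ _ _ _ (fun n => expR (- ((N n)%:R * x n / (1 - x n))))
  (fun n => expR (- ((N n)%:R * x n)))).
- near=> n; apply: exprB1_bounds; near: n.
  by apply: cvgr_lt x0 _ _; exact: ltr01.
- apply: continuous_cvg; first exact: continuous_expR.
  apply: cvgN; rewrite -[c]divr1; apply: cvgM => //.
  apply: cvgV; first exact: oner_neq0.
  by rewrite -[X in _ --> X]subr0; apply: cvgB => //; exact: cvg_cst.
- apply: continuous_cvg; first exact: continuous_expR.
  exact: cvgN.
Unshelve. all: by end_near.
Qed.

(** Serves [alpha < 1]: the upper exponential bound tends to 0, and the powers are nonnegative once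
    [x n < 1]. *)
Lemma cvg_exprB1_pinfty (R : realType) (N : nat -> nat) (x : nat -> R) :
  x n @[n --> \oo] --> (0 : R) -> (N n)%:R * x n @[n --> \oo] --> +oo ->
  (1 - x n) ^+ N n @[n --> \oo] --> (0 : R).
Proof.
move=> x0 Nx.
have x1 : \forall n \near \oo, x n < 1.
  by apply: cvgr_lt x0 _ _; exact: ltr01.
apply: (@squeeze_cvgr _ _ _ _ (fun=> 0) (fun n => expR (- ((N n)%:R * x n)))).
- near=> n; have xn1 : x n < 1 by near: n.
  have /andP[_ ->] := exprB1_bounds _ _ (N n) xn1.
  by rewrite andbT exprn_ge0 // subr_ge0 ltW.
- exact: cvg_cst.
- exact: (cvg_comp (fun n => (N n)%:R * x n) (fun y => expR (- y)) Nx (@cvgr_expR R)).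
Unshelve. all: by end_near.
Qed.

Lemma cvgn_powR (R : realType) (a : R) : 0 < a -> n%:R `^ a @[n --> \oo] --> +oo.
Proof.
move=> a0; apply/cvgryPge => A; near=> n.
apply: (le_trans (ler_norm A)).
rewrite -[leLHS]powRr1 // -[X in _ `^ X](mulVf (lt0r_neq0 a0)) powRrM.
apply: ge0_ler_powR; rewrite ?nnegrE ?powR_ge0 ?(ltW a0) //.
by near: n; exact: nbhs_infty_ger.
Unshelve. all: by end_near.
Qed.

Lemma cvgn_powRN (R : realType) (a : R) : 0 < a ->
  n%:R `^ (- a) @[n --> \oo] --> (0 : R).
Proof.
move=> a0; rewrite (_ : (fun n => _) = (fun n => (n%:R `^ a)^-1)); last first.
  by apply/funext => n; rewrite powRN.
apply/(gtr0_cvgV0 (f := fun n => n%:R `^ a)); last exact: cvgn_powR.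
by near=> n; rewrite powR_gt0 // ltr0n; near: n; exact: nbhs_infty_gt.
Unshelve. all: by end_near.
Qed.

(** Isolates the leading term, of order [1 - alpha], which decides between the three regimes; the
    other term vanishes as [alpha > 0]. *)
Lemma mul_predn_powRN (R : realType) (alpha lambda : R) (n : nat) : (0 < n)%N ->
  n.-1%:R * (lambda / n%:R `^ alpha)
  = lambda * n%:R `^ (1 - alpha) - lambda * n%:R `^ (- alpha).
Proof.
move=> n0; have nn0 : n%:R != 0 :> R by rewrite pnatr_eq0 -lt0n.
rewrite powRD ?nn0 ?implybT // powRr1 // powRN.
by rewrite -[in LHS]subn1 natrB //; lra.
Qed.

Theorem mainTheorem10 (R : realType) (alpha lambda : R) (p : nat -> R)
  (halpha : 0 < alpha) (hlambda : 0 < lambda)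
  (hp : \forall n \near \oo, p n = 1 - lambda / (n%:R `^ alpha)) :
  [/\ alpha < 1 ->
        shelf_prob (p n) (fun w : {ffun 'I_n -> bool} => X w == n)
          @[n --> \oo] --> (0 : R),
      alpha = 1 ->
        shelf_prob (p n) (fun w : {ffun 'I_n -> bool} => X w == n)
          @[n --> \oo] --> expR (- lambda)
    & 1 < alpha ->
        shelf_prob (p n) (fun w : {ffun 'I_n -> bool} => X w == n)
          @[n --> \oo] --> (1 : R)].
Proof.
have x0 : lambda / n%:R `^ alpha @[n --> \oo] --> (0 : R).
  rewrite -(mulr0 lambda); under eq_fun do rewrite -powRN.
  by apply: cvgMl_tmp; exact: cvgn_powRN.
have Nx0 : lambda * n%:R `^ (- alpha) @[n --> \oo] --> (0 : R).
  by under eq_fun do rewrite powRN.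
have NxE : {near \oo, (fun n => lambda * n%:R `^ (1 - alpha) - lambda * n%:R `^ (- alpha))
    =1 (fun n => n.-1%:R * (lambda / n%:R `^ alpha))}.
  near=> n; rewrite mul_predn_powRN //; near: n; exact: nbhs_infty_gt.
have probE : {near \oo, (fun n => (1 - lambda / n%:R `^ alpha) ^+ n.-1)
    =1 (fun n => shelf_prob (p n) (fun w : {ffun 'I_n -> bool} => X w == n))}.
  by near=> n; rewrite shelf_prob_X_eq; congr (_ ^+ _); apply/esym; near: n.
have Nx_cvg (c : R) : lambda * n%:R `^ (1 - alpha) @[n --> \oo] --> c ->
    n.-1%:R * (lambda / n%:R `^ alpha) @[n --> \oo] --> c.
  move=> cvg_c; apply: cvg_trans (near_eq_cvg NxE) _.
  by rewrite -[c]subr0; apply: cvgB.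
split=> a1; apply: cvg_trans (near_eq_cvg probE) _.
- apply: cvg_exprB1_pinfty => //; apply: cvg_trans (near_eq_cvg NxE) _.
  apply/cvgryPge => A; near=> n.
  have small : lambda * n%:R `^ (- alpha) <= 1.
    by near: n; apply: cvgr_le Nx0 _ _; exact: ltr01.
  (* The extra 1 in [A + 1] absorbs the subtracted term bounded by [small]. *)
  have large : (A + 1) / lambda <= n%:R `^ (1 - alpha).
    near: n; have := cvgn_powR _ (1 - alpha); rewrite subr_gt0 => /(_ a1).
    by move/cvgryPge; exact.
  by move: large; rewrite ler_pdivrMr // [X in _ <= X]mulrC; lra.
- apply: cvg_exprB1 => //; apply: Nx_cvg; rewrite a1 subrr.
  by under eq_fun do rewrite powRr0 mulr1; exact: cvg_cst.
(* For [alpha > 1] the leading term tends to 0, so the limit is [expR 0 = 1]. *)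
- have := cvg_exprB1 _ predn _ 0 x0; rewrite oppr0 expR0; apply; apply: Nx_cvg.
  rewrite -(mulr0 lambda); apply: cvgMl_tmp; rewrite -opprB.
  by apply: cvgn_powRN; rewrite subr_gt0.
Unshelve. all: by end_near.
Qed.
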